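(* Let $X$ be a pure simplicial complex of rank $n \geq 2$. If $|X|$ is an $n$-PCM or a discrete $n$-surface, then $X$ is a normal pseudomanifold of rank $n$.
   Context: Posets. For a poset $X$ with order $\le$ and $h\in X$, put $\alpha_X(h)=\{h'\in X: h'\le h\}$, $\beta_X(h)=\{h'\in X: h'\ge h\}$, $\theta_X(h)=\alpha_X(h)\cup\beta_X(h)$, and let $\alpha^{\square}_X(h),\beta^{\square}_X(h),\theta^{\square}_X(h)$ be these sets with $h$ removed. Any subset $S\subseteq X$ is regarded as a poset $|S|$ with the induced order. The rank $\mathrm{rk}(h,X)$ is $0$ if $\alpha^{\square}_X(h)=\emptyset$ and $1+\max_{x\in\alpha^{\square}_X(h)}\mathrm{rk}(x,X)$ otherwise; the rank of $X$ is the maximal rank of its elements, and $-1$ if $X=\emptyset$. A $k$-face of $X$ is an element of rank $k$. A path is a finite sequence $\langle p^0,\dots,p^k\rangle$ in $X$ with $p^i\in\theta^{\square}_X(p^{i-1})$ for $1\le i\le k$; $X$ is connected if any two elements are joined by a path in $X$. Discrete surfaces. A CF-order is a countable poset with all $\theta_X(h)$ finite. A CF-order $X$ is a (discrete) $(-1)$-surface if $X=\emptyset$; a $0$-surface if $X=\{x,y\}$ with $x\neq y$ and $x\notin\theta^{\square}_X(y)$; and, for $k\ge1$, a $k$-surface if it is non-empty, connected and $|\theta^{\square}_X(h)|$ is a $(k-1)$-surface for every $h\in X$. Border and PCM's. The border of a poset $X$ of rank $n\ge0$ is $\Delta X=\{h\in X: |\theta^{\square}_X(h)| \text{ is not an }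 (n-1)\text{-surface}\}$. A poset $X$ of rank $n$ is an $n$-PCM if: $n=-1$ and $X=\emptyset$; or $n=0$ and $X$ is a singleton; or $n\ge1$, $X$ is connected, $\Delta X\ne\emptyset$, and for every $h\in X$, $|\theta^{\square}_X(h)|$ is either an $(n-1)$-surface or an $(n-1)$-PCM. Simplicial complexes. A simplex is a non-empty finite set $h$, of dimension $\dim(h)=\#h-1$. A simplicial complex is a set of simplices containing every non-empty subset of each of its elements; it is viewed as a poset ordered by inclusion, so that rank equals dimension. The link of $h\in X$ is $\mathrm{lk}(h,X)=\{h'\in X: h\cap h'=\emptyset,\ h\cup h'\in X\}$, itself a simplicial complex. Pseudomanifolds. A simplicial complex of rank $n$ is pure if every $h\in X$ is contained in an $n$-face of $X$. A simplicial complex $X$ of rank $n$ is a pseudomanifold if either $n=0$ and $X$ consists of one single element, or $n\ge1$ and: $X$ is pure; each $(n-1)$-face of $X$ is a face of one or two $n$-faces of $X$; and any two $n$-faces of $X$ are joined by a path consisting only of $(n-1)$-faces and $n$-faces of $X$. A pseudomanifold $X$ of rank $n$ is normal if the link in $X$ of every face of dimension $d\le n-2$ is a pseudomanifold. *)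

(* Defs.v *)
From HB Require Import structures.
From mathcomp Require Import all_boot all_order all_algebra finmap.
From mathcomp Require Import boolp classical_sets functions cardinality.
Set Implicit Arguments.
Unset Strict Implicit.
Unset Printing Implicit Defensive.
Import Order.TTheory GRing.Theory Num.Theory.
Local Open Scope classical_set_scope.
Local Open Scope order_scope.

(* A poset is a subset [X : set T] of an ambient [porderType], with the
   induced order; an abstract poset [T] is the case [X = setT], and the poset
   |S| of a subset S of X is S itself. *)

Definition alpha d (T : porderType d) (X : set T) (h : T) : set T :=
  [set h' | X h' /\ h' <= h].

Definition beta d (T : porderType d) (X : set T) (h : T) : set T :=
  [set h' | X h' /\ h <= h'].

Definition theta d (T : porderType d) (X : set T) (h : T) : set T :=
  alpha X h `|` beta X h.

Definition alphao d (T : porderType d) (X : set T) (h : T) : set T :=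
  alpha X h `\ h.

Definition thetao d (T : porderType d) (X : set T) (h : T) : set T :=
  theta X h `\ h.

(* [elt_rank X h n] says that rk(h, X) is defined and equal to n; elements
   with infinite descending or unboundedly long chains below them have no
   rank. *)
Inductive elt_rank d (T : porderType d) (X : set T) : T -> nat -> Prop :=
| elt_rank0 h : X h -> alphao X h = set0 -> elt_rank X h 0
| elt_rankS h x n : X h -> alphao X h x -> elt_rank X x n ->
    (forall y, alphao X h y -> exists2 m, (m <= n)%N & elt_rank X y m) ->
    elt_rank X h n.+1.

Definition poset_rank d (T : porderType d) (X : set T) (r : int) : Prop :=
  (X = set0 /\ r = (-1)%R) \/
  (exists n : nat, [/\ r = Posz n,
     exists h, elt_rank X h n
   & forall h, X h -> exists2 m, (m <= n)%N & elt_rank X h m]).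

Definition kface d (T : porderType d) (X : set T) (k : nat) (h : T) : Prop :=
  elt_rank X h k.

(* The sequence <p^0, ..., p^k> is [x :: s] with x = p^0; it ends in
   [last x s]. *)
Definition poset_path d (T : porderType d) (X : set T) (x : T) (s : seq T) :
    Prop :=
  X x /\ path (fun p q => q \in thetao X p) x s.

Definition poset_connected d (T : porderType d) (X : set T) : Prop :=
  forall x y, X x -> X y -> exists2 s, poset_path X x s & last x s = y.

Definition cf_order d (T : porderType d) (X : set T) : Prop :=
  countable X /\ forall h, X h -> finite_set (theta X h).

Inductive surface d (T : porderType d) : int -> set T -> Prop :=
| surfaceN1 X : cf_order X -> X = set0 -> surface (-1)%R X
| surface0 X x y : cf_order X -> X = [set x; y] -> x <> y ->
    ~ thetao X y x -> surface 0%R X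
| surfaceS (k : int) X : (1 <= k)%R -> cf_order X -> X !=set0 ->
    poset_connected X ->
    (forall h, X h -> surface (k - 1)%R (thetao X h)) ->
    surface k X.

(* [n] stands for the rank of [X]. *)
Definition border d (T : porderType d) (n : int) (X : set T) : set T :=
  [set h | X h /\ ~ surface (n - 1)%R (thetao X h)].

Inductive pcm d (T : porderType d) : int -> set T -> Prop :=
| pcmN1 X : poset_rank X (-1)%R -> X = set0 -> pcm (-1)%R X
| pcm0 X x : poset_rank X 0%R -> X = [set x] -> pcm 0%R X
| pcmS (n : int) X : (1 <= n)%R -> poset_rank X n -> poset_connected X ->
    border n X !=set0 ->
    (forall h, X h ->
       surface (n - 1)%R (thetao X h) \/ pcm (n - 1)%R (thetao X h)) ->
    pcm n X.

Fact fsubset_display : Order.disp_t. Proof. exact: Order.Disp tt tt. Qed.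

Fact fsubset_lt_def (V : choiceType) (A B : {fset V}) :
  fproper A B = (B != A) && fsubset A B.
Proof. by rewrite fproperEneq eq_sym. Qed.

Fact fsubset_anti (V : choiceType) : antisymmetric (@fsubset V).
Proof. by move=> A B AB; apply/eqP; rewrite eqEfsubset. Qed.

HB.instance Definition _ (V : choiceType) :=
  Order.isPOrder.Build fsubset_display {fset V}
    (@fsubset_lt_def V) (@fsubset_refl V) (@fsubset_anti V)
    (@fsubset_trans V).

Lemma fset_leE (V : choiceType) (A B : {fset V}) : (A <= B) = fsubset A B.
Proof. by []. Qed.

Definition simplicial_complex (V : choiceType) (X : set {fset V}) : Prop :=
  (forall h, X h -> h != fset0) /\
  (forall h h' : {fset V}, X h -> h' != fset0 -> fsubset h' h -> X h').

(* Meaningful for non-empty [h] only. *)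
Definition simplex_dim (V : choiceType) (h : {fset V}) : nat := (#|` h|).-1.

Definition link (V : choiceType) (h : {fset V}) (X : set {fset V}) :
    set {fset V} :=
  [set h' | [/\ X h', fsetI h h' = fset0 & X (fsetU h h')]].

(* [n] stands for the rank of [X]. *)
Definition pure (V : choiceType) (n : nat) (X : set {fset V}) : Prop :=
  forall h, X h -> exists2 g, kface X n g & fsubset h g.

(* [cofaces X n f] is the set of n-faces of X of which f is a face. *)
Definition cofaces (V : choiceType) (X : set {fset V}) (n : nat)
    (f : {fset V}) : set {fset V} :=
  [set g | kface X n g /\ fsubset f g].

Definition pseudomanifold (V : choiceType) (n : nat) (X : set {fset V}) :
    Prop :=
  [/\ simplicial_complex X, poset_rank X (Posz n)
    & (n = 0%N /\ exists h, X = [set h]) \/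
      [/\ (1 <= n)%N,
          pure n X,
          forall f, kface X n.-1 f ->
            (exists g, cofaces X n f = [set g]) \/
            (exists g g', g <> g' /\ cofaces X n f = [set g; g'])
        & forall g g', kface X n g -> kface X n g' ->
            exists s, [/\ poset_path X g s, last g s = g'
              & forall p, p \in g :: s -> kface X n.-1 p \/ kface X n p]]].

(* The dimension bound d <= n - 2 is written d + 2 <= n, as subtraction on
   [nat] is truncated. *)
Definition normal_pseudomanifold (V : choiceType) (n : nat)
    (X : set {fset V}) : Prop :=
  pseudomanifold n X /\
  forall h, X h -> (simplex_dim h + 2 <= n)%N ->
    exists m, pseudomanifold m (link h X).

(* Main.v *)
Require Import Defs.
From mathcomp Require Import all_boot all_order all_algebra finmap.
From mathcomp Require Import boolp classical_sets functions cardinality.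
From mathcomp Require Import zify.

(** Surfaces and PCM's share one recursive property, and it is all the proof
    uses: at rank 0 there are one or two points, and at rank n + 1 the poset is
    connected and each [thetao X h] has the property at rank n. This is
    [locally_connected] below. It depends only on the order, so it passes along
    poset isomorphisms ([locally_connected_image]).

    For a vertex [v] of a simplicial complex, the elements of
    [thetao X [fset v]] are the proper cofaces of [v], and removing [v] from
    them is an isomorphism onto the link of [v]. So the link of a vertex
    inherits the property with the rank lowered by one. Since the link of
    [h `|` u] is the link of [u] in the link of [h] ([link_link]), removing
    vertices one at a time shows that the link of every face [h] with [n]
    vertices or fewer has the property at rank [n - #|` h|]
    ([link_locally_connected]). Purity is inherited by links in the same way,
    so it remains to show that a pure complex with the property at rank
    [n >= 1] is a pseudomanifold; this is then applied to the complex and to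
    its links.

    - The cofaces of an (n-1)-face [f] correspond to the points of its link,
      which has the property at rank 0: there are one or two.
    - For strong connectedness, induct on the rank. A path in [X] between two
      facets goes through comparable faces; enclose each in a facet. Two
      consecutive facets then have a vertex [v] in common, and the induction
      hypothesis in the link of [v], with [v] added back, joins them through
      facets and ridges ([locally_connected_strongly]). *)

Set Implicit Arguments.
Unset Strict Implicit.
Unset Printing Implicit Defensive.
Import Order.TTheory GRing.Theory Num.Theory.
Local Open Scope classical_set_scope.

(** * Reachability in a poset *)

Definition reach d (T : porderType d) (S : set T) (x y : T) : Prop :=
  exists2 s, poset_path S x s & last x s = y.

Lemma thetaoP d (T : porderType d) (S : set T) (x y : T) :
  thetao S x y <-> [/\ S y, (x >=< y)%O & x <> y].
Proof.
split=> [[[[Sy le]|[Sy le]] ne]|[Sy /orP[le|le] ne]].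
- by split=> //; [rewrite /Order.comparable le orbT|move/esym].
- by split=> //; [rewrite /Order.comparable le|move/esym].
- by split; [right|move/esym].
- by split; [left|move/esym].
Qed.

Lemma reach_refl d (T : porderType d) (S : set T) (x : T) :
  S x -> reach S x x.
Proof. by move=> Sx; exists [::]. Qed.

Lemma reach_trans d (T : porderType d) (S : set T) (x y z : T) :
  reach S x y -> reach S y z -> reach S x z.
Proof.
move=> [s [Sx ps] <-] [t [_ pt] <-]; exists (s ++ t); last by rewrite last_cat.
by split=> //; rewrite cat_path ps.
Qed.

Lemma reach_step d (T : porderType d) (S : set T) (x y : T) :
  S x -> S y -> (x >=< y)%O -> reach S x y.
Proof.
move=> Sx Sy cxy; have [<-|/eqP ne] := eqVneq x y; first exact: reach_refl.
exists [:: y] => //; split=> //=; rewrite andbT; apply/mem_set.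
exact/thetaoP.
Qed.

(** Lets arguments along a path avoid its sequence: the target [y] is fixed and
    [P] only has to move one comparability step away from it at a time. *)
Lemma reach_ind d (T : porderType d) (S : set T) (y : T) (P : T -> Prop) :
  (S y -> P y) ->
  (forall x z, S x -> S z -> (x >=< z)%O -> P z -> P x) ->
  forall x, reach S x y -> P x.
Proof.
move=> Py step x [s [Sx]]; elim: s x Sx => [x Sx _ /= xy|z s IH x Sx /=].
  by rewrite xy; apply: Py; rewrite -xy.
move=> /andP[/set_mem/thetaoP[Sz cxz _] pz] lz.
exact: step Sx Sz cxz (IH z Sz pz lz).
Qed.

Lemma reach_map d (T : porderType d) d' (T' : porderType d')
    (S : set T) (S' : set T') (f : T -> T') :
  (forall x, S x -> S' (f x)) ->
  (forall x y, S x -> S y -> (x <= y)%O -> (f x <= f y)%O) ->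
  forall x y, reach S x y -> reach S' (f x) (f y).
Proof.
move=> fS fle x y.
apply: (@reach_ind _ _ S y (fun x => reach S' (f x) (f y))) => [|{}x z Sx Sz].
  by move=> Sy; exact/reach_refl/fS.
move=> cxz; apply/reach_trans/reach_step; [exact: fS..|].
by case/orP: cxz => /fle le; apply/orP; [left|right]; exact: le.
Qed.

Lemma reach_path_in d (T : porderType d) (S X : set T) (x y : T) :
  S `<=` X -> reach S x y ->
  exists s, [/\ poset_path X x s, last x s = y &
    forall p, p \in x :: s -> S p].
Proof.
move=> SX [s [Sx]]; elim: s x Sx => [x Sx _ <-|z s IH x Sx /=].
  exists [::]; split=> [||p] //; first by split=> //; exact: SX.
  by rewrite inE => /eqP->.
move=> /andP[/set_mem/thetaoP[Sz cxz ne] pz] /(IH z Sz pz)[t [[Xz pt] lt St]].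
exists (z :: t); split=> [|//|p].
  split; [exact: SX|rewrite /= pt andbT; apply/mem_set/thetaoP].
  by split=> //; exact: SX.
by rewrite inE => /predU1P[->|/St].
Qed.

(** * A common weakening of surfaces and PCM's *)

(** At rank 0 the two points may coincide or be comparable: this covers the
    singleton of a 0-PCM along with the pair of a 0-surface, and only their
    number matters for counting cofaces. *)
Fixpoint locally_connected d (T : porderType d) (n : nat) (X : set T) : Prop :=
  if n is m.+1 then
    poset_connected X /\ forall h, X h -> locally_connected m (thetao X h)
  else exists x y, X = [set x; y].

Lemma surface_locally_connected d (T : porderType d) (n : nat) (X : set T) :
  surface (Posz n) X -> locally_connected n X.
Proof.
elim: n X => [|n IH] X sX.
  inversion sX as [|Y x y _ XE|k Y] => //; by exists x, y.
inversion sX as [| |k Y _ _ _ cX tX] => //; split=> // h /tX.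
by rewrite intS addrC addKr => /IH.
Qed.

Lemma pcm_locally_connected d (T : porderType d) (n : nat) (X : set T) :
  pcm (Posz n) X -> locally_connected n X.
Proof.
elim: n X => [|n IH] X sX.
  inversion sX as [|Y x _ XE|k Y] => //; exists x, x; by rewrite XE setUid.
inversion sX as [| |k Y _ _ cX _ tX] => //; split=> // h /tX.
by rewrite intS addrC addKr => -[/surface_locally_connected|/IH].
Qed.

Lemma thetao_image d (T : porderType d) d' (T' : porderType d')
    (X : set T) (f : T -> T') :
  (forall x y, X x -> X y -> (f x <= f y)%O = (x <= y)%O) ->
  forall h, X h -> thetao (f @` X) (f h) = f @` thetao X h.
Proof.
move=> fle h Xh; rewrite eqEsubset; split=> z.
  move=> /thetaoP[[x Xx <-]].
  rewrite /Order.comparable !fle // => ch ne; exists x => //; apply/thetaoP.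
  by split=> // hx; apply: ne; rewrite hx.
case=> x /thetaoP[Xx ch ne] <-; apply/thetaoP; split; first by exists x.
  by rewrite /Order.comparable !fle.
move=> fhx; apply: ne; apply/eqP; rewrite eq_le -!fle // fhx.
by rewrite lexx.
Qed.

Lemma locally_connected_image d (T : porderType d) d' (T' : porderType d')
    (n : nat) (X : set T) (f : T -> T') :
  (forall x y, X x -> X y -> (f x <= f y)%O = (x <= y)%O) ->
  locally_connected n X -> locally_connected n (f @` X).
Proof.
elim: n X => [|n IH] X fle /=.
  by move=> [x [y XE]]; exists (f x), (f y); rewrite XE image_setU !image_set1.
move=> [cX tX]; split=> [_ _ [x Xx <-] [y Xy <-]|_ [h Xh <-]].
  apply: (@reach_map _ _ _ _ X) (cX _ _ Xx Xy).
    by move=> z Xz; exists z.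
  by move=> a b Xa Xb; rewrite fle.
rewrite thetao_image //; apply: IH (tX _ Xh).
by move=> x y /thetaoP[Xx _ _] /thetaoP[Xy _ _]; exact: fle.
Qed.

(** * Rank and dimension in a simplicial complex *)

Section Complex.
Local Open Scope fset_scope.
Context (V : choiceType).
Implicit Types (X : set {fset V}) (f g h u : {fset V}) (n : nat).

Lemma alphaoP X h u : alphao X h u <-> X u /\ u `<` h.
Proof.
rewrite fproperEneq; split=> [[[Xu uh] /eqP ne]|[Xu /andP[/eqP ne uh]]].
  by rewrite ne.
by split.
Qed.

(** A rank defined by chains is a dimension here, because removing a vertex
    from a simplex lowers the cardinal by exactly one and stays in the
    complex. *)
Lemma kfaceE X : simplicial_complex X ->
  forall n h, kface X n h <-> X h /\ #|` h| = n.+1.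
Proof.
move=> [X0 Xsub]; elim/ltn_ind=> n IH h.
have removal u v : X u -> v \in u -> (1 < #|` u|)%N -> alphao X u (u `\ v).
  move=> Xu vu u1; apply/alphaoP; split; last exact: fproperD1.
  apply: Xsub Xu _ (fsubD1set _ _).
  by rewrite -cardfs_gt0; move: u1; rewrite (cardfsD1 v) vu.
have gt0 u : X u -> (0 < #|` u|)%N by move=> /X0; rewrite -cardfs_gt0.
split.
  move=> hn; have Xh : X h by case: hn.
  split=> //; have /fset0Pn[v vh] := X0 _ Xh.
  have hv := cardfsD1 v h; rewrite vh in hv.
  case: n IH hn => [|n] IH hn; inversion hn as [k _ h0|k x m _ hx xn hy].
    apply/eqP; rewrite eqn_leq gt0 // andbT leqNgt; apply/negP => h1.
    by have := removal _ _ Xh vh h1; rewrite h0.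
  have [_ xE] := (IH n (ltnSn n) x).1 xn; have [_ xh] := (alphaoP _ _ _).1 hx.
  have := fproper_ltn_card xh; rewrite xE => h1.
  have hva : alphao X h (h `\ v) by apply: removal => //; lia.
  have [m' m'n /(IH m' m'n)[_ hvE]] := hy _ hva.
  apply/eqP; rewrite eqn_leq h1 andbT hv hvE; lia.
move=> [Xh hn]; have /fset0Pn[v vh] := X0 _ Xh.
have hv := cardfsD1 v h; rewrite vh in hv.
case: n IH hn => [|n] IH hn.
  apply: elt_rank0 => //; rewrite -subset0 => u /alphaoP[/gt0 u0].
  by move=> /fproper_ltn_card; rewrite hn ltnS leqNgt u0.
have hva : alphao X h (h `\ v) by apply: removal => //; rewrite hn.
apply: (elt_rankS Xh hva).
  by apply/IH => //; split; [case/alphaoP: hva|lia].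
move=> u /alphaoP[Xu /fproper_ltn_card uh]; exists #|` u|.-1.
  by have := gt0 _ Xu; lia.
by apply/IH; have := gt0 _ Xu; [lia|split=> //; lia].
Qed.

Lemma pureP n X : simplicial_complex X ->
  pure n X <-> forall h, X h -> exists g, [/\ X g, #|` g| = n.+1 & h `<=` g].
Proof.
move=> cX; split=> pX h /pX.
  by move=> [g /(kfaceE cX)[Xg gn] hg]; exists g.
by move=> [g [Xg gn hg]]; exists g => //; apply/kfaceE.
Qed.

Lemma pure_card n X : simplicial_complex X -> pure n X ->
  forall h, X h -> (0 < #|` h| <= n.+1)%N.
Proof.
move=> cX /(pureP _ cX) pX h Xh; rewrite cardfs_gt0 cX.1 //=.
by have [g [_ <-]] := pX _ Xh; exact: fsubset_leq_card.
Qed.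

Lemma pure_rank n X : simplicial_complex X -> X !=set0 -> pure n X ->
  poset_rank X (Posz n).
Proof.
move=> cX [h Xh] pX; right; exists n; split=> //.
  by have [g [Xg gn _]] := (pureP _ cX).1 pX _ Xh; exists g; apply/kfaceE.
move=> u Xu; have u1 := pure_card cX pX Xu; exists #|` u|.-1; first lia.
by apply/(kfaceE cX); split=> //; lia.
Qed.

(** * Links *)

Lemma link_complex X h : simplicial_complex X -> simplicial_complex (link h X).
Proof.
move=> [X0 Xsub]; split=> [u [/X0 //]|u w [Xu hu Xhu] w0 wu].
split; first exact: Xsub wu.
  by apply/eqP; rewrite -fsubset0 -hu; exact: fsetIS.
apply: Xsub Xhu _ (fsetUS _ wu).
by apply: contra_neq w0 => /eqP; rewrite fsetU_eq0 => /andP[_ /eqP].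
Qed.

Lemma fsetUDK h g : h `<=` g -> h `|` (g `\` h) = g.
Proof.
move=> hg; apply/fsetP => x; rewrite !inE.
by have [/(fsubsetP hg)->|] := boolP (x \in h).
Qed.

Lemma linkD X h g : simplicial_complex X -> X g -> h `<=` g -> h != g ->
  link h X (g `\` h).
Proof.
move=> [X0 Xsub] Xg hg ne; split; last by rewrite fsetUDK.
  apply: Xsub Xg _ (fsubsetDl _ _); rewrite fsetD_eq0.
  by apply: contra ne => gh; rewrite eqEfsubset hg.
by rewrite fsetIDA; apply/eqP; rewrite fsetD_eq0 fsubsetIl.
Qed.

Lemma link0 X : link fset0 X = X.
Proof.
by rewrite eqEsubset; split=> u; [case|split=> //; rewrite ?fset0I ?fset0U].
Qed.

(** This is what lets a statement on links of all faces be proved on links of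
    vertices alone. *)
Lemma link_link X h u : simplicial_complex X -> h `&` u = fset0 ->
  link u (link h X) = link (h `|` u) X.
Proof.
move=> [X0 Xsub] hu; rewrite eqEsubset; split=> w.
  move=> [[Xw hw Xhw] uw [Xuw _ Xhuw]].
  by split; rewrite // ?fsetIUl ?hw ?uw ?fsetU0 // -fsetUA.
move=> [Xw /eqP]; rewrite fsetIUl fsetU_eq0 => /andP[/eqP hw /eqP uw] Xhuw.
have sub y : w `<=` y -> y `<=` h `|` u `|` w -> X y.
  move=> wy; apply: Xsub Xhuw _; apply: contra_neq (X0 _ Xw) => y0.
  by apply/eqP; rewrite -fsubset0 -y0.
split=> //.
  by split=> //; apply: sub; rewrite ?fsubsetUr // fsetSU // fsubsetUl.
split; last by rewrite fsetUA.
  by apply: sub; rewrite ?fsubsetUr // -fsetUA fsubsetUr.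
by rewrite fsetIUr hu hw fsetU0.
Qed.

(** Nothing lies strictly below a vertex, so comparable means containing it. *)
Lemma thetao_vertexP X v g : simplicial_complex X ->
  thetao X [fset v] g <-> [/\ X g, v \in g & [fset v] != g].
Proof.
move=> cX; split=> [/thetaoP[Xg vg /eqP ne]|[Xg vg /eqP ne]]; last first.
  by apply/thetaoP; split; rewrite // /Order.comparable !fset_leE fsub1set vg.
split=> //; move: vg; rewrite /Order.comparable !fset_leE fsub1set => /orP[//|].
by rewrite fsubset1 (negbTE (cX.1 _ Xg)) orbF => /eqP gv; rewrite gv eqxx in ne.
Qed.

Lemma vertex_link X v : simplicial_complex X ->
  link [fset v] X =
    ((fun g : {fset V} => (g `\ v)%fset) @` thetao X [fset v])%classic.
Proof.
move=> cX; rewrite eqEsubset; split=> u; last first.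
  move=> [g /(thetao_vertexP _ _ cX)[Xg vg ne] <-].
  by apply: linkD; rewrite ?fsub1set.
move=> [Xu vu Xvu].
have vNu : v \notin u by rewrite -fdisjoint1X -fsetI_eq0 vu.
exists (v |` u); last by rewrite fsetU1K.
apply/(thetao_vertexP _ _ cX); split; rewrite ?fset1U1 //.
apply: contra_neq (cX.1 _ Xu) => vE.
by rewrite -(fsetU1K vNu) -vE fsetDv.
Qed.

Lemma vertex_link_locally_connected n X v : simplicial_complex X ->
  X [fset v] -> locally_connected n.+1 X ->
  locally_connected n (link [fset v] X).
Proof.
move=> cX Xv [_ /(_ _ Xv) tX]; rewrite vertex_link //.
apply: locally_connected_image tX => g h.
move=> /(thetao_vertexP _ _ cX)[_ vg _] /(thetao_vertexP _ _ cX)[_ vh _].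
rewrite !fset_leE; apply/idP/idP => [gh|]; last exact: fsetSD.
by rewrite -(fsetD1K vg) -(fsetD1K vh) fsetUS.
Qed.

(** Remove the vertices of [h] one at a time. *)
Lemma link_locally_connected n X h : simplicial_complex X -> X h ->
  (#|` h| <= n)%N -> locally_connected n X ->
  locally_connected (n - #|` h|) (link h X).
Proof.
(* Weakened so that the induction can end at the empty set of vertices. *)
move=> + Xh; have {Xh} : h != fset0 -> X h by [].
have [k] := ubnP #|` h|; elim: k => // k IH in n X h *.
move=> hk Xh cX hn lX; have [h0|h0] := eqVneq h fset0.
  by rewrite h0 cardfs0 subn0 link0.
have {}Xh := Xh h0; have /fset0Pn[v vh] := h0.
have hv := cardfsD1 v h; rewrite vh in hv.
have Xv : X [fset v].
  by apply: cX.2 Xh _ _; rewrite ?fsub1set // -cardfs_gt0 cardfs1.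
rewrite -(fsetD1K vh) -link_link //; last first.
  by rewrite fsetIDA; apply/eqP; rewrite fsetD_eq0 fsubsetIl.
rewrite fsetD1K // hv; case: n => [|n] in hn lX *; first by lia.
rewrite subSS; apply: IH; [lia| |exact: link_complex|lia|].
  move=> hv0; apply: linkD => //; rewrite ?fsub1set //.
  by apply: contra_neq hv0 => <-; rewrite fsetDv.
exact: vertex_link_locally_connected.
Qed.

(** A facet containing [h `|` u], with [h] removed, is a facet of the link
    containing [u]. *)
Lemma link_pure n X h : simplicial_complex X -> pure n X ->
  pure (n - #|` h|) (link h X).
Proof.
move=> cX /(pureP _ cX) pX; apply/(pureP _ (link_complex _ cX)) => u.
move=> [Xu hu Xhu]; have [g [Xg gn hug]] := pX _ Xhu.
have hg : h `<=` g := fsubset_trans (fsubsetUl _ _) hug.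
have ug : u `<=` g := fsubset_trans (fsubsetUr _ _) hug.
have ne : h != g.
  apply: contra_neq (cX.1 _ Xu) => hE; move/fsetIidPr: ug.
  by rewrite -hE hu.
exists (g `\` h); split; first exact: linkD.
  have : h `<` g by rewrite fproperEneq ne.
  by move=> /fproper_ltn_card; rewrite cardfsDS // gn; lia.
by rewrite fsubsetD ug -fsetI_eq0 fsetIC hu eqxx.
Qed.

Lemma link_nonempty n X h : simplicial_complex X -> pure n X -> X h ->
  (#|` h| <= n)%N -> link h X !=set0.
Proof.
move=> cX /(pureP _ cX) pX Xh hn; have [g [Xg gn hg]] := pX _ Xh.
exists (g `\` h); apply: linkD => //; apply: contraTneq hn => ->; lia.
Qed.

(** * Pseudomanifolds *)

(** Indexed so that the rank of [X] is [n.+1]: a facet has [n.+2] vertices. *)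
Definition ridges_and_facets n X : set {fset V} :=
  [set p | X p /\ (#|` p| = n.+1 \/ #|` p| = n.+2)]%classic.

Definition strongly_connected n X : Prop := forall g g',
  X g -> X g' -> #|` g| = n.+2 -> #|` g'| = n.+2 ->
  reach (ridges_and_facets n X) g g'.

(** Removing [v] from facets that contain it gives facets of its link; adding
    [v] back to a path in the link gives a path in [X] one dimension higher. *)
Lemma star_reach n X v a b : simplicial_complex X ->
  strongly_connected n (link [fset v] X) ->
  X a -> X b -> #|` a| = n.+3 -> #|` b| = n.+3 -> v \in a -> v \in b ->
  reach (ridges_and_facets n.+1 X) a b.
Proof.
move=> cX sX Xa Xb an bn va vb.
have lk g : X g -> #|` g| = n.+3 -> v \in g ->
    link [fset v] X (g `\ v) /\ #|` g `\ v| = n.+2.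
  move=> Xg gn vg; split; last by have := cardfsD1 v g; rewrite vg gn; lia.
  apply: linkD => //; rewrite ?fsub1set //.
  by apply: contra_eq_neq gn => <-; rewrite cardfs1.
rewrite -(fsetD1K va) -(fsetD1K vb).
have [la an'] := lk _ Xa an va; have [lb bn'] := lk _ Xb bn vb.
apply: reach_map (sX _ _ la lb an' bn') => [u [[_ vu Xvu] un]|u w _ _ uw].
  have vNu : v \notin u by rewrite -fdisjoint1X -fsetI_eq0 vu.
  by split=> //; rewrite cardfsU1 vNu; lia.
by rewrite fset_leE fsetUS.
Qed.

(** Comparable faces [p] and [q] share a vertex [v], so any facet around [p]
    and any facet around [q] both contain [v] and are joined inside its star by
    the induction hypothesis on its link. Purity supplies the facets along a
    path of [X]. *)
Lemma locally_connected_strongly n X : simplicial_complex X -> pure n.+1 X ->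
  locally_connected n.+1 X -> strongly_connected n X.
Proof.
elim: n X => [|n IH] X cX pX lX g g' Xg Xg' gn gn'.
  (* In a graph every face is a ridge or a facet. *)
  suff <- : X = ridges_and_facets 0 X by apply: lX.1.
  rewrite eqEsubset; split=> [u Xu|u [] //]; split=> //.
  by have := pure_card cX pX Xu; lia.
have star v a b : X a -> X b -> #|` a| = n.+3 -> #|` b| = n.+3 ->
    v \in a -> v \in b -> reach (ridges_and_facets n.+1 X) a b.
  move=> Xa Xb an bn va vb; apply: star_reach (va) (vb) => //.
  have Xv : X [fset v].
    by apply: cX.2 Xa _ _; rewrite ?fsub1set // -cardfs_gt0 cardfs1.
  apply: IH; [exact: link_complex| |exact: vertex_link_locally_connected].
  by have := link_pure (h := [fset v]) cX pX; rewrite cardfs1 subSS subn0.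
have facet := (pureP _ cX).1 pX.
(* Generalized to every facet around the start of the path, as the induction
   along the path changes the facet. *)
suff near : forall a, X a -> #|` a| = n.+3 -> g `<=` a ->
    reach (ridges_and_facets n.+1 X) a g' by exact: near.
apply: (@reach_ind _ _ X g' (fun p => forall a, X a -> #|` a| = n.+3 ->
    p `<=` a -> reach (ridges_and_facets n.+1 X) a g')); last exact: lX.1.
  move=> _ a Xa an g'a; have /fset0Pn[v vg'] := cX.1 _ Xg'.
  exact: star (fsubsetP g'a _ vg') vg'.
move=> p q Xp Xq pq IHq a Xa an pa; have [c [Xc cn qc]] := facet _ Xq.
apply: reach_trans (IHq _ Xc cn qc).
have [v [vp vq]] : exists v, v \in p /\ v \in q.
  move: pq; rewrite /Order.comparable !fset_leE => /orP[] /fsubsetP sub.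
    by have /fset0Pn[v vp] := cX.1 _ Xp; exists v; split=> //; exact: sub.
  by have /fset0Pn[v vq] := cX.1 _ Xq; exists v; split=> //; exact: sub.
exact: star (fsubsetP pa _ vp) (fsubsetP qc _ vq).
Qed.

Lemma cofaces_link n X h : simplicial_complex X -> pure n X -> X h ->
  #|` h| = n -> cofaces X n h = (fsetU h @` link h X)%classic.
Proof.
move=> cX pX Xh hn; rewrite eqEsubset; split=> g.
  move=> [/(kfaceE cX)[Xg gn] hg]; exists (g `\` h); last exact: fsetUDK.
  by apply: linkD => //; apply: contra_eq_neq gn => <-; lia.
move=> [u [Xu hu Xhu] <-]; split; last exact: fsubsetUl.
apply/(kfaceE cX); split=> //; have /andP[_ le] := pure_card cX pX Xhu.
have /andP[u0 _] := pure_card cX pX Xu.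
by have := cardfsUI h u; rewrite hu cardfs0; lia.
Qed.

Lemma locally_connected_pseudomanifold n X : (1 <= n)%N ->
  simplicial_complex X -> X !=set0 -> pure n X -> locally_connected n X ->
  pseudomanifold n X.
Proof.
case: n => // n _ cX X0 pX lX; split=> //; first exact: pure_rank.
right; split=> //.
  move=> f /(kfaceE cX)[Xf fn]; rewrite cofaces_link //.
  have := link_locally_connected cX Xf (eq_leq fn) lX.
  rewrite fn subnn => -[x [y ->]]; rewrite image_setU !image_set1.
  have [<-|/eqP ne] := eqVneq (f `|` x) (f `|` y); last first.
    by right; exists (f `|` x), (f `|` y).
  by left; exists (f `|` x); rewrite setUid.
move=> g g' /(kfaceE cX)[Xg gn] /(kfaceE cX)[Xg' gn'].
have := locally_connected_strongly cX pX lX Xg Xg' gn gn'.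
move=> /(@reach_path_in _ _ _ X)[|s [ps ls sS]]; first by move=> p [].
exists s; split=> // p /sS[Xp [pn|pn]]; [left|right]; exact/kfaceE.
Qed.

End Complex.

Theorem theorem1 (V : choiceType) (n : nat) (X : set {fset V})
    (hn : (2 <= n)%N) (hX : simplicial_complex X)
    (hrank : poset_rank X (Posz n)) (hpure : pure n X)
    (hPS : pcm (Posz n) X \/ surface (Posz n) X) :
  normal_pseudomanifold n X.
Proof.
have lX : locally_connected n X.
  by case: hPS => [/pcm_locally_connected|/surface_locally_connected].
have X0 : X !=set0.
  by case: hrank => [[_ //]|[m [_ [h hm] _]]]; exists h; case: hm.
split; first by apply: locally_connected_pseudomanifold => //; lia.
move=> h Xh; rewrite /simplex_dim => hdim; exists (n - #|` h|)%N.
have /andP[h0 _] := pure_card hX hpure Xh.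
apply: locally_connected_pseudomanifold; [lia| | | |].
- exact: link_complex.
- by apply: link_nonempty hpure _ _ => //; lia.
- exact: link_pure.
- by apply: link_locally_connected => //; lia.
Qed.
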